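(* Let $\tau$ be a regular uncountable cardinal, and let $X$ and $Y$ be Tychonoff spaces each of which has a network of cardinality less than $\tau$. Suppose that $C_p(X\times \tau)$ is homeomorphic to $C_p(Y\times \tau)$. Then there exists a non-zero ordinal $\lambda<\tau$ such that $C_p(X\times \lambda)$ is homeomorphic to $C_p(Y\times \lambda)$.
   Context: For a Tychonoff space $Z$, $C_p(Z)$ denotes the set of all continuous functions $Z\to\mathbb R$ with the topology of pointwise convergence (the subspace topology inherited from the product $\mathbb R^Z$). Homeomorphisms between function spaces are not assumed to be linear. Each ordinal is regarded as the set of smaller ordinals with the order topology, and products carry the product topology. A network of a space $X$ is a family $\mathcal N$ of (not necessarily open) subsets of $X$ such that for every $x\in X$ and every open $U\ni x$ there is $N\in\mathcal N$ with $x\in N\subset U$. *)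

(* Defs.v *)
From HB Require Import structures.
From mathcomp Require Import all_boot all_order all_algebra.
From mathcomp Require Import all_classical all_reals all_analysis.
From mathcomp.classical Require wochoice.

Set Implicit Arguments.
Unset Strict Implicit.
Unset Printing Implicit Defensive.

Import Order.TTheory GRing.Theory Num.Theory.
Import numFieldNormedType.Exports.

Local Open Scope classical_set_scope.
Local Open Scope card_scope.

Definition homeomorphic (S T : topologicalType) : Prop :=
  exists (f : S -> T) (g : T -> S),
    [/\ cancel f g, cancel g f, continuous f & continuous g].

(* Complete regularity is the library's, stated through uniform separators;
   see tychonoff_spaceP for the formulation with real-valued functions. *)
Definition tychonoff_space (Z : topologicalType) : Prop :=
  hausdorff_space Z /\ completely_regular_space Z.

Lemma tychonoff_spaceP (R : realType) (Z : topologicalType) :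
  tychonoff_space Z <->
  hausdorff_space Z /\
  forall (a : Z) (B : set Z), closed B -> ~ B a ->
    exists f : Z -> R, [/\ continuous f,
      range f `<=` `[0%R, 1%R], f a = 0%R & f @` B `<=` [set 1%R]].
Proof.
split=> -[hZ cZ]; split=> // a B cB Ba.
  have /(@uniform_separatorP _ R)[f [cf f01 fa fB]] := cZ a B cB Ba.
  by exists f; split=> //; apply: fa; exists a.
have [f [cf f01 fa fB]] := cZ a B cB Ba.
apply/(@uniform_separatorP _ R); exists f; split=> //.
by move=> _ [_ -> <-].
Qed.

(* A subset of a topological space, used as a type, carries the subspace
   topology; {ptws Z -> R} is the product space R^Z. *)
Definition Cp (R : realType) (Z : topologicalType) : topologicalType :=
  [set f : {ptws Z -> R} | continuous (f : Z -> R)] : Type.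

Definition network (X : topologicalType) (N : set (set X)) : Prop :=
  forall (x : X) (U : set X), open U -> U x ->
    exists2 A, N A & A x /\ A `<=` U.

Definition card_lt (S T : Type) (A : set S) (B : set T) : Prop :=
  A #<= B /\ ~ (B #<= A).

(* An ordinal is represented by a well-ordered type T, which plays the role of
   the set of smaller ordinals; the element a of T then stands for the ordinal
   [0, a[, so that the ordinals below T are the types [below a]. *)
Definition below d (T : orderType d) (a : T) : orderType d :=
  sub_type {x : T | (x < a)%O}.

Definition cofinal d (T : orderType d) (A : set T) : Prop :=
  forall x : T, exists2 y, A y & (x <= y)%O.

(* The second clause says that the ordinal T is initial, i.e. a cardinal; the
   last one that its cofinality is T itself. *)
Definition regular_uncountable_cardinal d (T : orderType d) : Prop :=
  [/\ wochoice.well_order (<=%O : rel T),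
      forall a : T, card_lt [set: below a] [set: T],
      ~ countable [set: T] &
      forall A : set T, cofinal A -> A #= [set: T]].

(* Main.v *)
Require Import Defs.
From HB Require Import structures.
From mathcomp Require Import all_boot all_order all_algebra.
From mathcomp Require Import all_classical all_reals all_analysis.
From mathcomp Require Import lra.
From mathcomp.classical Require wochoice.

Set Implicit Arguments.
Unset Strict Implicit.
Unset Printing Implicit Defensive.

Import Order.TTheory GRing.Theory Num.Theory.
Import numFieldNormedType.Exports.

Local Open Scope classical_set_scope.

(* Let E_a be the set of functions on X * tau that are constant in the second
   variable from a on; it is closed and is a copy of C_p(X * (a + 1)).  Since X
   has a network smaller than tau, every continuous function lies in some E_a,
   and each E_a has a dense subset smaller than tau.  By regularity a
   homeomorphism therefore maps E_a into some E'_b, and likewise backwards.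
   Choose a limit l closed under both maps a |-> b.  As E_l is the closure of
   the union of the E_a for a < l, the homeomorphism maps E_l onto E'_l, so
   lambda = l + 1 works. *)

(* For a regular uncountable cardinal T this captures "of cardinality < T",
   in a form whose closure properties need no cardinal arithmetic. *)
Definition small d (T : orderType d) (A : Type) : Prop :=
  forall g : A -> T, exists b : T, forall a : A, (g a <= b)%O.

Lemma small_prod d (T : orderType d) (A B : Type) :
  small T A -> small T B -> small T (A * B).
Proof.
move=> sA sB g.
have [h hP] := choice (fun a => sB (fun b => g (a, b))).
have [c cP] := sA h.
by exists c => -[a b]; exact: le_trans (hP a b) (cP a).
Qed.

(** * Boundedness and closing-off arguments in a regular uncountable cardinal *)

Section regular_cardinal.
Context {d : Order.disp_t} {T : orderType d}.
Hypothesis rT : regular_uncountable_cardinal T.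
Local Open Scope card_scope.

(** An unbounded [g] has cofinal range, which by regularity is equipotent with [T]; so [A] would be
    at least as large as [T]. *)
Lemma small_card (A : Type) : ~ ([set: T] #<= [set: A]) -> small T A.
Proof.
move=> nTA g; apply: contrapT => nb; apply: nTA.
suff Tg : [set: T] #<= range g by exact: card_le_trans Tg (card_image_le _ _).
have [_ _ _ /(_ (range g)) eqT] := rT.
have /eqT : cofinal (range g).
  move=> x; have [a xa] : exists a, (x <= g a)%O.
    apply: contrapT => na; apply: nb; exists x => a.
    by rewrite leNgt; apply/negP => /ltW xa; apply: na; exists a.
  by exists (g a).
by rewrite card_eq_sym => /card_eqPle[].
Qed.

Lemma small_lt (S : Type) (N : set S) :
  card_lt N [set: T] -> small T N.
Proof.
move=> [_ nTN]; apply: small_card => TN; apply: nTN.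
by rewrite -(card_le_eqr (card_setT N)).
Qed.

Lemma small_below (a : T) : small T (below a).
Proof. by have [_ /(_ a)[_ nTa] _ _] := rT; exact: small_card. Qed.

Lemma small_count (I : countType) : small T I.
Proof.
apply: small_card => TI; have [_ _ ncT _] := rT.
by apply: ncT; apply: sub_countable TI _; exact: countableP.
Qed.

(** Sequences of a fixed length are bounded by induction on the length; the countably many bounds so
    obtained are bounded in turn. *)
Lemma small_seq (A : Type) : small T A -> small T (seq A).
Proof.
move=> sA.
have sn n (g : seq A -> T) : exists b, forall s, size s = n -> (g s <= b)%O.
  elim: n g => [|n IH] g; first by exists (g [::]) => -[].
  have [h hP] := choice (fun a => IH (fun s => g (a :: s))).
  have [c cP] := sA h; exists c => -[//|a s] [sn].
  exact: le_trans (hP a s sn) (cP a).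
move=> g; have [h hP] := choice (fun n => sn n g).
have [c cP] := small_count h.
by exists c => s; exact: le_trans (hP (size s) s erefl) (cP _).
Qed.

(** Were [a] the greatest element, its singleton would be cofinal and regularity would make [T]
    countable. *)
Lemma exists_gt (a : T) : exists b : T, (a < b)%O.
Proof.
apply: contrapT => na; have [_ _ ncT /(_ [set a]) eqT] := rT; apply: ncT.
have /eqT/card_eqPle[_ Ta] : cofinal [set a].
  move=> x; exists a => //; rewrite leNgt; apply/negP => ax.
  by apply: na; exists x.
exact: sub_countable Ta (countable1 _).
Qed.

Lemma exists_least (P : set T) : P !=set0 ->
  exists2 z, P z & forall y, P y -> (z <= y)%O.
Proof.
move=> [x Px]; have [wT _ _ _] := rT.
have /wT[z [[zP zl] _]] : wochoice.nonempty [pred x | `[< P x >]].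
  by exists x; rewrite inE.
by exists z => [|y Py]; [move: zP; rewrite inE | apply: zl; rewrite inE].
Qed.

(** The usual closing-off: [l] is the least upper bound of an omega-sequence along which each term
    dominates the values of [h] up to the previous one. As [h a] exceeds [a], such an [l] is a
    limit. *)
Lemma exists_closed_under (h : T -> T) : (forall a, (a < h a)%O) ->
  exists2 l : T, (exists a, (a < l)%O) & forall a, (a < l)%O -> (h a < l)%O.
Proof.
move=> hgt.
(* A bound for the empty family is a point of [T]. *)
have [a0 _] := small_count (@of_void T).
(* Since [h] need not be monotone, [u a] has to exceed [h] on the whole segment up to [a], not only
   at [a]. *)
have /choice[u uP] a : exists c, forall b, (b <= a)%O -> (h b < c)%O.
  have [a' aa'] := exists_gt a.
  have [c cP] := small_below (fun b : below a' => h (val b)).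
  have [c' cc'] := exists_gt c; exists c' => b ba.
  by apply: le_lt_trans cc'; exact: (cP (Sub b (le_lt_trans ba aa'))).
pose s n := iter n u a0.
have [|l lub lst] := @exists_least [set z | forall n, (s n <= z)%O].
  by have [b bP] := small_count s; exists b.
have sl n b : (b <= s n)%O -> (h b < l)%O.
  by move=> /uP; move=> /lt_le_trans; apply; exact: (lub n.+1).
exists l => [|b bl]; first by exists (h a0); exact: (sl 0%N).
have [n bn] : exists n, (b < s n)%O.
  apply: contrapT => nb; move: bl; rewrite ltNge => /negP; apply; apply: lst.
  by move=> n; rewrite leNgt; apply/negP => ?; apply: nb; exists n.
exact: sl (ltW bn).
Qed.

End regular_cardinal.

(** * One-sided neighbourhoods and continuity in the order topology *)

Section order_topology_facts.
Context {d : Order.disp_t} {T : orderType d}.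
Implicit Type x : order_topology T.

(** For points [c <= x] the right end of an open interval around [x] imposes nothing, so only its
    left end matters. *)
Lemma nbhs_order_left x (U : set (order_topology T)) (a : T) : (a < x)%O ->
  nbhs x U -> exists2 b : T, (b < x)%O & forall c : T, (b < c <= x)%O -> U c.
Proof.
move=> ax; rewrite order_nbhs_itv => -[[l r] [iop xi] iU].
move: xi; rewrite itv_boundlr => /andP[lx xr].
have rP (c : T) : (c <= x)%O -> (BRight c <= r)%O.
  by move=> cx; apply: le_trans xr; rewrite bnd_simp.
case: l iop lx iU => [[] l|bl] iop lx iU.
- by move: (itv_open_ends_lside iop).
- exists l => [|c /andP[lc cx]]; first by move: lx; rewrite bnd_simp.
  by apply: iU; rewrite /= itv_boundlr rP// bnd_simp lc.
(* The interval is unbounded on the left, and [a] stands in for the missing end. *)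
- exists a => // c /andP[ac cx]; apply: iU.
  by rewrite /= itv_boundlr rP// (itv_open_ends_linfty iop).
Qed.

Lemma continuous_order_rays (S : topologicalType) (f : S -> order_topology T) :
  (forall a : T, open [set s | (f s < a)%O]) ->
  (forall a : T, open [set s | (a < f s)%O]) -> continuous f.
Proof.
move=> flt fgt s U; rewrite order_nbhs_itv => -[[l r] [iop si] iU].
move: si; rewrite itv_boundlr => /andP[ls sr].
have nl : nbhs s [set t | (l <= BLeft (f t))%O].
  case: l iop ls {iU} => [[] l|bl] iop ls.
  - by move: (itv_open_ends_lside iop).
  - by apply: open_nbhs_nbhs; split; [exact: fgt|move: ls; rewrite /= bnd_simp].
  - by apply: nearW => t; rewrite (itv_open_ends_linfty iop).
have nr : nbhs s [set t | (BRight (f t) <= r)%O].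
  case: r iop sr {iU} => [[] r|br] iop sr.
  - by apply: open_nbhs_nbhs; split; [exact: flt|move: sr; rewrite /= bnd_simp].
  - by move: (itv_open_ends_rside iop).
  - by apply: nearW => t; rewrite (itv_open_ends_rinfty iop).
apply: filterS (filterI nl nr) => t [lt tr]; apply: iU.
by rewrite /= itv_boundlr lt tr.
Qed.

End order_topology_facts.

Lemma open_lt d (T : orderTopologicalType d) (a : T) : open [set x | (x < a)%O].
Proof. by have := lray_open a; rewrite set_itvE. Qed.

Lemma open_gt d (T : orderTopologicalType d) (a : T) : open [set x | (a < x)%O].
Proof. by have := rray_open a; rewrite set_itvE. Qed.

(** * The retraction of [T] onto [[0, l]], realised as [below m] for [m] the successor of [l] *)

Section truncation.
Context {d : Order.disp_t} {T : orderType d} (l m : T).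
Hypotheses (lm : (l < m)%O) (mP : forall a : T, (a < m)%O -> (a <= l)%O).

Definition below_val (a : order_topology (below m)) : order_topology T := val a.

(** A ray of [T] with end [a < m] traces a ray on [below m]; with end at or beyond [m] it traces
    everything or nothing. *)
Lemma below_val_continuous : continuous below_val.
Proof.
apply: continuous_order_rays => a.
  have [am|ma] := ltP a m.
    exact: (@open_lt _ (order_topology (below m)) (Sub a am)).
  rewrite (_ : [set _ | _] = setT); first exact: openT.
  by apply/seteqP; split=> // b _ /=; exact: lt_le_trans (valP b) ma.
have [am|ma] := ltP a m.
  exact: (@open_gt _ (order_topology (below m)) (Sub a am)).
rewrite (_ : [set _ | _] = set0); first exact: open0.
apply/seteqP; split=> // b /= ab.
by have := lt_trans (le_lt_trans ma ab) (valP b); rewrite ltxx.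
Qed.

Lemma truncate_subproof (a : T) : (Order.min a l < m)%O.
Proof. by rewrite gt_min lm orbT. Qed.

Definition truncate (a : order_topology T) : order_topology (below m) :=
  Sub (Order.min a l) (truncate_subproof a).

(** Elements of [below m] are at most [l], so the preimage of a ray is the ray of [T] with the same
    end, or is empty. *)
Lemma truncate_continuous : continuous truncate.
Proof.
apply: continuous_order_rays => a.
  have al : (val a <= l)%O by exact: mP (valP a).
  rewrite (_ : [set _ | _] = [set b : T | (b < val a)%O]).
    exact: (@open_lt _ (order_topology T)).
  apply/seteqP; split=> b /=.
    rewrite -[(_ < a)%O]/(Order.min b l < val a)%O gt_min => /orP[//|].
    by rewrite ltNge al.
  by rewrite -[(_ < a)%O]/(Order.min b l < val a)%O gt_min => ->.
have [la|al] := leP l (val a).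
  rewrite (_ : [set _ | _] = set0); first exact: open0.
  apply/seteqP; split=> // b /=.
  rewrite -[(a < _)%O]/(val a < Order.min b l)%O lt_min => /andP[_].
  by rewrite ltNge la.
rewrite (_ : [set _ | _] = [set b : T | (val a < b)%O]).
  exact: (@open_gt _ (order_topology T)).
apply/seteqP; split=> b /=.
  by rewrite -[(a < _)%O]/(val a < Order.min b l)%O lt_min => /andP[].
by rewrite -[(a < _)%O]/(val a < Order.min b l)%O lt_min al andbT.
Qed.

End truncation.

Local Open Scope ring_scope.

(** * The topology of pointwise convergence *)

Section Cp_topology.
Context {R : realType}.
Implicit Types Z W : topologicalType.

Definition evalCp Z (f : Cp R Z) : Z -> R := set_val f.

Lemma evalCp_continuous Z (f : Cp R Z) : continuous (evalCp f).
Proof. exact: (set_mem (valP f)). Qed.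

Definition mkCp Z (f : Z -> R) (cf : continuous f) : Cp R Z :=
  exist _ (f : {ptws Z -> R}) (mem_set cf).

Lemma evalCp_inj Z : injective (@evalCp Z).
Proof. by move=> f g fg; exact: val_inj. Qed.

Lemma continuous_evalCp Z (z : Z) : continuous (fun f : Cp R Z => evalCp f z).
Proof.
move=> f; apply: (@continuous_comp _ {ptws Z -> R} _ set_val (fun g => g z)).
  exact: initial_continuous.
exact: (@proj_continuous Z (fun=> R)).
Qed.

(** The sets satisfying the conclusion form a filter [G]. It converges to [f] in each coordinate,
    hence in the product, so it contains every neighbourhood of [f]. *)
Lemma nbhs_ptws Z (f : {ptws Z -> R}) (V : set {ptws Z -> R}) : nbhs f V ->
  exists (s : seq Z) (e : R), 0 < e /\
    forall g : Z -> R, (forall z, z \in s -> `|f z - g z| < e) -> V g.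
Proof.
pose G : set_system {ptws Z -> R} := [set V | exists (s : seq Z) (e : R),
  0 < e /\ forall g : Z -> R, (forall z, z \in s -> `|f z - g z| < e) -> V g].
have GF : Filter G.
  split=> [|P Q [s [e [e0 sP]]] [t [e' [e'0 tQ]]]|P Q PQ [s [e [e0 sP]]]].
  - by exists [::], 1.
  - exists (s ++ t), (Num.min e e'); split; first by rewrite lt_min e0.
    move=> g fg; split; [apply: sP|apply: tQ] => z zs.
      by have := fg z; rewrite mem_cat zs lt_min => /(_ isT)/andP[].
    by have := fg z; rewrite mem_cat zs orbT lt_min => /(_ isT)/andP[].
  - by exists s, e; split=> // g /sP/PQ.
suff : G --> f by exact.
apply/cvg_sup => z; apply/cvg_image.
  (* Constant functions show that the projection to the coordinate [z] is onto. *)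
  by apply/seteqP; split=> // y _; exists (fun=> y).
move=> A /nbhs_ballP[e /= e0 eA]; exists ((fun g : Z -> R => g z) @^-1` A).
  by exists [:: z], e; split=> // g /(_ z (mem_head _ _)); exact: eA.
by rewrite image_preimage//; apply/seteqP; split=> // y _; exists (fun=> y).
Qed.

Lemma nbhs_Cp Z (f : Cp R Z) (U : set (Cp R Z)) : nbhs f U ->
  exists (s : seq Z) (e : R), 0 < e /\
    forall g : Cp R Z,
      (forall z, z \in s -> `|evalCp f z - evalCp g z| < e) -> U g.
Proof.
case=> _ [[V oV <-] /= Vf VU].
have /nbhs_ptws[s [e [e0 sV]]] : nbhs (set_val f : {ptws Z -> R}) V.
  exact: open_nbhs_nbhs.
by exists s, e; split=> // g fg; apply: VU; exact: sV.
Qed.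

Lemma continuous_to_Cp (S : topologicalType) Z (F : S -> Cp R Z) :
  (forall z, continuous (fun s => evalCp (F s) z)) -> continuous F.
Proof.
move=> cF s U /nbhs_Cp[t [e [e0 tU]]].
suff : nbhs s [set x | forall z, z \in t ->
    `|evalCp (F s) z - evalCp (F x) z| < e].
  by apply: filterS => x; exact: tU.
elim: {tU} t => [|z t IH]; first exact: nearW.
have zF : nbhs s [set x | `|evalCp (F s) z - evalCp (F x) z| < e].
  by have /cvgrPdist_lt/(_ _ e0) := cF z s.
apply: filterS (filterI zF IH) => x [zx tx] w.
by rewrite inE => /orP[/eqP->|/tx].
Qed.

Definition pullCp Z W (p : Z -> W) (cp : continuous p) (f : Cp R W) : Cp R Z :=
  mkCp (fun z => continuous_comp (cp z) (@evalCp_continuous W f (p z))).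

Lemma pullCp_continuous Z W (p : Z -> W) (cp : continuous p) :
  continuous (pullCp cp).
Proof. by apply: continuous_to_Cp => z; exact: continuous_evalCp. Qed.

End Cp_topology.

Lemma continuous_subr (R : realType) (S : topologicalType) (f g : S -> R) :
  continuous f -> continuous g -> continuous (fun x => f x - g x).
Proof. by move=> cf cg x; apply: cvgB; [exact: cf|exact: cg]. Qed.

Lemma continuous_pair_map (X S W : topologicalType) (p : S -> W) :
  continuous p -> continuous (fun z : X * S => (z.1, p z.2)).
Proof.
move=> cp z; apply: cvg_pair; first exact: cvg_fst.
by apply: continuous_comp (cp z.2); exact: cvg_snd.
Qed.

Lemma continuous_pairr (X S : topologicalType) (x : X) :
  continuous (fun s : S => (x, s)).
Proof. by move=> s /=; apply: cvg_pair; [exact: cvg_cst|exact: cvg_id]. Qed.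

Lemma continuous_pairl (X S : topologicalType) (s : S) :
  continuous (fun x : X => (x, s)).
Proof. by move=> x /=; apply: cvg_pair; [exact: cvg_id|exact: cvg_cst]. Qed.

(** * Functions constant in the second variable from some point on *)

Section tail_constant.
Context {R : realType} {d : Order.disp_t} {T : orderType d}.
Context {X : topologicalType}.
Local Notation XT := (X * order_topology T)%type.
Local Notation C := (Cp R XT).

(** This is the set [E_a] of the overview. *)
Definition const_from (a : T) : set C :=
  [set f : C | forall (x : X) (b : T), (a <= b)%O ->
    evalCp f (x, b) = evalCp f (x, a)].

Lemma const_from_le (a b : T) : (a <= b)%O -> const_from a `<=` const_from b.
Proof.
by move=> ab f fa x c bc; rewrite !(fa x)//; exact: le_trans bc.
Qed.

(** Each condition is the vanishing of a difference of two evaluations, which is continuous in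
    [f]. *)
Lemma closed_const_from (a : T) : closed (const_from a).
Proof.
rewrite (_ : const_from a = \bigcap_(z in [set z : X * T | (a <= z.2)%O])
    [set f : C | evalCp f z - evalCp f (z.1, a) = 0]).
  apply: closed_bigI => z _.
  have cz : continuous (fun f : C => evalCp f z - evalCp f (z.1, a)).
    by apply: continuous_subr; exact: continuous_evalCp.
  by have /continuous_closedP := cz => /(_ [set 0]); apply; exact: closed_eq.
apply/seteqP; split=> [f fa [x b] /= ab|f fa x b ab].
  by rewrite fa// subrr.
by apply/eqP; rewrite -subr_eq0; apply/eqP; exact: (fa (x, b)).
Qed.

Lemma continuous_slice (f : C) (x : X) :
  continuous (fun b : order_topology T => evalCp f (x, b)).
Proof.
move=> b.
apply: (@continuous_comp (order_topology T) XT R (fun b => (x, b)) (evalCp f)).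
  exact: continuous_pairr.
exact: evalCp_continuous.
Qed.

Lemma continuous_slicel (f : C) (b : T) :
  continuous (fun x : X => evalCp f (x, b)).
Proof.
move=> x.
apply: (@continuous_comp X XT R (fun x => (x, b)) (evalCp f)).
  exact: continuous_pairl.
exact: evalCp_continuous.
Qed.

Lemma continuous_cap (a : T) :
  continuous (fun b : order_topology T => Order.min b a : order_topology T).
Proof.
have cid : continuous (id : order_topology T -> order_topology T).
  by move=> b; exact: cvg_id.
have cst : continuous (fun _ : order_topology T => a : order_topology T).
  exact: cst_continuous.
exact: (min_fun_continuous cid cst).
Qed.

(* [f] composed with the retraction of [X * T] onto [X * [0, a]]. *)
Definition freeze (a : T) : C -> C :=
  pullCp (continuous_pair_map (@continuous_cap a)).

Lemma freeze_const_from (a : T) (f : C) : const_from a (freeze a f).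
Proof.
move=> x b ab; rewrite /freeze.
rewrite -[LHS]/(evalCp f (x, Order.min b a)).
by rewrite -[RHS]/(evalCp f (x, Order.min a a)) minxx min_r.
Qed.

(** The approximants are [freeze b f] with [b] close to [l] from below. At [(x, c)] with [c < l]
    they agree with [f] once [b] passes [c]; for [c >= l] they take the value of [f] at [(x, b)],
    which tends to its value at [(x, l)]. *)
Lemma freeze_dense (l : T) (f : C) :
  (exists a, (a < l)%O) ->
  (forall a, (a < l)%O -> exists2 b, (a < b)%O & (b < l)%O) ->
  const_from l f ->
  closure (\bigcup_(a in [set a | (a < l)%O]) const_from a) f.
Proof.
move=> [a0 a0l] lim fl U /nbhs_Cp[s [e [e0 sU]]].
(* A basic neighbourhood involves finitely many points, so the thresholds below [l] found for each
   of them have a maximum below [l]. *)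
have [a al aP] : exists2 a, (a < l)%O & forall b, (a < b < l)%O ->
    forall z, z \in s -> `|evalCp f z - evalCp (freeze b f) z| < e.
  elim: {sU} s => [|[x c] s [a al aP]]; first by exists a0.
  have [a' a'l a'P] : exists2 a', (a' < l)%O & forall b, (a' < b < l)%O ->
      `|evalCp f (x, c) - evalCp f (x, Order.min c b)| < e.
    have [cl|lc] := ltP c l.
      exists c => // b /andP[cb _].
      by rewrite min_l ?subrr ?normr0// ltW.
    have : nbhs (l : order_topology T)
        [set b : order_topology T | `|evalCp f (x, l) - evalCp f (x, b)| < e].
      by have /cvgrPdist_lt/(_ _ e0) := @continuous_slice f x l.
    move=> /(nbhs_order_left a0l)[a' a'l a'P]; exists a' => // b /andP[a'b bl].
    rewrite fl// min_r; last exact: le_trans (ltW bl) lc.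
    by apply: a'P; rewrite a'b ltW.
  exists (Order.max a a'); first by rewrite gt_max al.
  move=> b; rewrite gt_max => /andP[/andP[ab a'b] bl] z.
  rewrite inE => /orP[/eqP->|/aP]; first by apply: a'P; rewrite a'b.
  by apply; rewrite ab.
have [b ab bl] := lim a al.
exists (freeze b f); split; first by exists b => //; exact: freeze_const_from.
by apply: sU; apply: aP; rewrite ab.
Qed.

End tail_constant.

(** * Eventual constancy of continuous functions *)

Section regular_tail_constant.
Context {R : realType} {d : Order.disp_t} {T : orderType d}.
Hypothesis rT : regular_uncountable_cardinal T.

(** Otherwise every [a] has a later [u a] where [h] has moved by more than [e]. Such jumps would
    occur arbitrarily close below a limit [l] closed under [u], against continuity at [l]. *)
Lemma slice_nearly_const (h : order_topology T -> R) (e : R) : 0 < e ->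
  continuous h -> exists a : T, forall b : T, (a <= b)%O -> `|h b - h a| <= e.
Proof.
move=> e0 ch; apply: contrapT => nh.
have /choice[u uP] (a : T) : exists b : T, (a < b)%O /\ e < `|h b - h a|.
  apply: contrapT => na; apply: nh; exists a => b.
  rewrite le_eqVlt => /orP[/eqP<-|ab]; first by rewrite subrr normr0 ltW.
  by rewrite leNgt; apply/negP => eb; apply: na; exists b.
have [l [a al] lP] := exists_closed_under rT (fun a => (uP a).1).
have : nbhs (l : order_topology T)
    [set b : order_topology T | `|h l - h b| < e / 2].
  by have /cvgrPdist_lt/(_ (e / 2)) := ch l; apply; rewrite divr_gt0.
move=> /(nbhs_order_left al)[b bl bP].
(* The jump used goes from [u b] to [u (u b)], because [bP] controls only points strictly above
   [b]. *)
have ubl := lP b bl; have uubl := lP _ ubl.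
have [bub _] := uP b; have [ubuub] := uP (u b).
apply/negP; rewrite -leNgt (splitr e).
apply: le_trans (ler_distD (h l) _ _) _; apply: lerD.
  by rewrite distrC ltW// bP// (lt_trans bub)//= ltW.
by rewrite ltW// bP// bub ltW.
Qed.

Context {X : topologicalType} {N : set (set X)}.
Hypotheses (netN : network N) (smN : small T N).
Local Notation XT := (X * order_topology T)%type.
Local Notation C := (Cp R XT).

(** Choose a point in each nonempty member of the network. A common bound [a] of the stabilisation
    ordinals at these points, over all precisions, works: if [f] differed at [(x, a)] and [(x, b)],
    it would do so at the chosen point of some network member around [x]. *)
Lemma exists_const_from (f : C) : exists a, const_from a f.
Proof.
(* The value [None] serves the empty member of the network. *)
have /choice[p pP] (A : N) : exists x : option X,
    forall y, val A y -> exists2 z, x = Some z & val A z.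
  have [[x Ax]|nA] := pselect (exists x, val A x); last first.
    by exists None => y Ay; case: nA; exists y.
  by exists (Some x) => y _; exists x.
have /choice[h hP] (An : N * nat) : exists a : T, forall z, p An.1 = Some z ->
    forall b : T, (a <= b)%O ->
    `|evalCp f (z, b) - evalCp f (z, a)| <= An.2.+1%:R^-1.
  case: (p An.1) => [z|]; last first.
    by have [a _] := small_count rT (@of_void T); exists a.
  have [|a aP] := slice_nearly_const (e := An.2.+1%:R^-1) _
      (@continuous_slice _ _ _ _ f z); first by rewrite invr_gt0.
  by exists a => _ [<-].
have [a ha] := small_prod smN (@small_count _ _ rT nat) h.
exists a => x b ab; apply: contrapT => fab.
have [||A NA [Ax AU]] := netN (x := x)
   (U := [set y | evalCp f (y, b) - evalCp f (y, a) != 0]).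
- apply: (@open_comp _ _ (fun y => evalCp f (y, b) - evalCp f (y, a))
    [set r | r != 0]).
    by move=> y _; apply: continuous_subr; exact: continuous_slicel.
  exact: open_neq.
- by rewrite /= subr_eq0; exact/eqP.
have [y py Ay] := pP (exist _ A (mem_set NA)) x Ax.
have /negP := AU y Ay; apply; rewrite -normr_le0.
apply/ler_addgt0Pr => e e0; rewrite add0r.
have [n ne] : exists n, n.+1%:R^-1 < e / 2.
  have e20 : 0 < e / 2 by rewrite divr_gt0.
  have [n _ /(_ n (leqnn n))] := near_infty_natSinv_lt (PosNum e20).
  by exists n.
(* Both [a] and [b] lie beyond the ordinal [c] attached to [A] and [n], so the values there differ
   from the one at [c] by less than [e / 2]. *)
have yP := hP (exist _ A (mem_set NA), n) y py.
have ca := ha (exist _ A (mem_set NA), n).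
set c := h _ in yP ca.
apply: le_trans (ler_distD (evalCp f (y, c)) _ _) _.
rewrite (splitr e); apply: lerD.
  by apply: le_trans (yP b (le_trans ca ab)) (ltW ne).
by rewrite distrC; apply: le_trans (yP a ca) (ltW ne).
Qed.

End regular_tail_constant.

(** * Small dense subsets and their images under continuous maps *)

Section density.
Context {R : realType} {d : Order.disp_t} {T : orderType d}.
Hypothesis rT : regular_uncountable_cardinal T.
Context {X : topologicalType} {N : set (set X)}.
Hypotheses (netN : network N) (smN : small T N).
Local Notation XT := (X * order_topology T)%type.
Local Notation C := (Cp R XT).

(** Finite lists of conditions, each sending a network member at a level up to [a] into a rational
    interval, cut out sets [E i] that form a network of [const_from a]. One function is picked from
    each nonempty [E i]. *)
Lemma const_from_small_dense (a : T) :
  exists (I : Type) (F : I -> C), [/\ small T I, forall i, const_from a (F i) &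
    const_from a `<=` closure (range F)].
Proof.
(* Going past [a] makes the level [a] itself available in [below a']. *)
have [a' aa'] := exists_gt rT a.
pose box (t : N * below a' * (rat * rat)) : set C := [set g : C |
  forall x, val t.1.1 x ->
    ratr t.2.1 < evalCp g (x, val t.1.2) < ratr t.2.2].
pose E (i : seq (N * below a' * (rat * rat))) : set C :=
  [set g : C | const_from a g /\ forall t, t \in i -> box t g].
(* The default for an empty [E i]; being constant, it still lies in [const_from a]. *)
pose f0 : C := mkCp (@cst_continuous XT R 0).
exists (seq (N * below a' * (rat * rat))), (fun i => xget f0 (E i)); split.
- apply: small_seq => //; apply: small_prod; last exact: small_count.
  by apply: small_prod => //; exact: small_below.
- by move=> i; case: xgetP => [g _ []|].
move=> f fa U /nbhs_Cp[s [e [e0 sU]]].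
have /choice[t tP] (z : X * T) : exists t, box t f /\
    forall g, const_from a g -> box t g -> `|evalCp f z - evalCp g z| < e.
  case: z => x c.
  (* Functions in [const_from a] do not distinguish level [c] from its cap at [a], so the condition
     is imposed at the capped level. *)
  have ca' : (Order.min c a < a')%O by rewrite gt_min aa' orbT.
  have capE (g : C) : const_from a g ->
      evalCp g (x, c) = evalCp g (x, Order.min c a).
    move=> ga; have [ca|ac] := leP c a; first by [].
    by rewrite ga// ltW.
  set v := evalCp f (x, c).
  have e20 : 0 < e / 2 by rewrite divr_gt0.
  have [p] : exists p : rat, ratr p \in `]v - e / 2, v[.
    by apply: rat_in_itvoo; rewrite ltrBlDr ltrDl.
  rewrite in_itv /= => /andP[vp pv].
  have [q] : exists q : rat, ratr q \in `]v, v + e / 2[.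
    by apply: rat_in_itvoo; rewrite ltrDl.
  rewrite in_itv /= => /andP[vq qv].
  have [||A NA [Ax AU]] := netN (x := x)
      (U := (fun y => evalCp f (y, Order.min c a)) @^-1`
        [set` `]ratr p, ratr q[]).
  - apply: open_comp => [y _|]; first exact: continuous_slicel.
    exact: itv_open.
  - by rewrite /= in_itv/= -capE// pv.
  pose b : below a' := Sub (Order.min c a) ca'.
  exists ((exist _ A (mem_set NA) : N), b, (p, q)); split.
    by move=> y /AU; rewrite /= in_itv.
  move=> g ga /(_ x Ax) /=; rewrite -capE// => /andP[pg gq].
  by rewrite ltr_norml; lra.
have Ef : E (map t s) f.
  by split=> // _ /mapP[z zs ->]; exact: (tP z).1.
have [Ea Eb] := xgetPex f0 (ex_intro _ f Ef).
exists (xget f0 (E (map t s))); split; first by exists (map t s).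
by apply: sU => z zs; apply: (tP z).2 => //; apply: Eb; exact: map_f.
Qed.

(** A small dense subset of [const_from a] has its images in a single closed set [const_from b], by
    boundedness of the ordinals involved; continuity carries this over to the closure. *)
Lemma const_from_image (Y : topologicalType) (M : set (set Y))
    (F : C -> Cp R (Y * order_topology T)%type) :
  network M -> small T M -> continuous F ->
  forall a, exists b, (a < b)%O /\
    forall f, const_from a f -> const_from b (F f).
Proof.
move=> netM smM cF a.
have [I [G [smI Ga Gd]]] := const_from_small_dense a.
have /choice[h hP] i := exists_const_from rT netM smM (F (G i)).
have [b0 hb0] := smI h.
have [b b0b] := exists_gt rT (Order.max a b0).
move: b0b; rewrite gt_max => /andP[ab b0b].
exists b; split=> // f fa; apply: closed_const_from => V /cF.
move=> /(Gd f fa)[_ [[i _ <-] VG]]; exists (F (G i)); split=> //.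
by apply: const_from_le (hP i); exact: le_trans (hb0 i) (ltW b0b).
Qed.

End density.

(** The inclusion holds on the union of the stages below [l], since [h] stays below [l]. That union
    is dense in stage [l], and the target is closed. *)
Lemma const_from_closure_image (R : realType) (d : Order.disp_t)
    (T : orderType d) (X Y : topologicalType)
    (F : Cp R (X * order_topology T)%type -> Cp R (Y * order_topology T)%type)
    (l : T) (h : T -> T) :
  continuous F -> (exists a, (a < l)%O) ->
  (forall a, (a < h a)%O) -> (forall a, (a < l)%O -> (h a < l)%O) ->
  (forall a f, const_from a f -> const_from (h a) (F f)) ->
  forall f, const_from l f -> const_from l (F f).
Proof.
move=> cF l0 hgt hl hF f fl; apply: closed_const_from => V /cF.
have := @freeze_dense R d T X l f l0 _ fl; move=> /(_ _)/[apply].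
case=> [a al|g [[a al ga] Vg]]; first by exists (h a) => //; exact: hl.
exists (F g); split=> //.
by apply: const_from_le (hF a g ga); rewrite ltW// hl.
Qed.

(** * The functions constant from [l] on as a copy of the function space over [[0, l]] *)

Section extension.
Context {R : realType} {d : Order.disp_t} {T : orderType d} {l m : T}.
Hypotheses (lm : (l < m)%O) (mP : forall a : T, (a < m)%O -> (a <= l)%O).
Context {X : topologicalType}.
Local Notation CT := (Cp R (X * order_topology T)%type).
Local Notation Cm := (Cp R (X * order_topology (below m))%type).

Definition restrictCp : CT -> Cm :=
  pullCp (continuous_pair_map (@below_val_continuous d T m)).

Definition extendCp : Cm -> CT :=
  pullCp (continuous_pair_map (@truncate_continuous d T l m lm mP)).

Lemma extendCp_const_from (f : Cm) : const_from l (extendCp f).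
Proof.
move=> x b lb; rewrite -[LHS]/(evalCp f (x, truncate lm b)).
rewrite -[RHS]/(evalCp f (x, truncate lm l)).
by congr (evalCp f (x, _)); apply: val_inj; rewrite /= minxx min_r.
Qed.

Lemma extendCpK : cancel extendCp restrictCp.
Proof.
move=> f; apply: evalCp_inj; apply/funext => -[x b].
rewrite -[LHS]/(evalCp f (x, truncate lm (below_val b))).
by congr (evalCp f (x, _)); apply: val_inj; exact: min_l (mP (valP b)).
Qed.

(** Beyond [l] both sides take the value of [f] at level [l]. *)
Lemma restrictCpK (f : CT) : const_from l f -> extendCp (restrictCp f) = f.
Proof.
move=> fl; apply: evalCp_inj; apply/funext => -[x b].
rewrite -[LHS]/(evalCp f (x, Order.min b l)).
by have [//|lb] := leP b l; rewrite (fl _ _ (ltW lb)).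
Qed.

End extension.

Lemma restrict_extend_continuous (R : realType) (d : Order.disp_t)
    (T : orderType d) (l m : T) (lm : (l < m)%O)
    (mP : forall a : T, (a < m)%O -> (a <= l)%O) (X Y : topologicalType)
    (F : Cp R (X * order_topology T)%type -> Cp R (Y * order_topology T)%type) :
  continuous F ->
  continuous (fun f => restrictCp (m := m) (F (extendCp lm mP f))).
Proof.
move=> cF f U nU.
exact: (pullCp_continuous (cF _ _ (pullCp_continuous nU))).
Qed.

Theorem theorem2p2 (R : realType) (d : Order.disp_t) (tau : orderType d)
    (X Y : topologicalType) :
  regular_uncountable_cardinal tau ->
  tychonoff_space X -> tychonoff_space Y ->
  (exists N : set (set X), network N /\ card_lt N [set: tau]) ->
  (exists N : set (set Y), network N /\ card_lt N [set: tau]) ->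
  homeomorphic (Cp R (X * order_topology tau)%type)
               (Cp R (Y * order_topology tau)%type) ->
  exists lambda : tau,
    (exists alpha : tau, (alpha < lambda)%O) /\
    homeomorphic (Cp R (X * order_topology (below lambda))%type)
                 (Cp R (Y * order_topology (below lambda))%type).
Proof.
move=> rT _ _ [N [netN /(small_lt rT) smN]] [M [netM /(small_lt rT) smM]].
move=> [F [G [FK GK cF cG]]].
have /choice[u uP] := const_from_image rT netN smN netM smM cF.
have /choice[v vP] := const_from_image rT netM smM netN smN cG.
(* Taking the maximum makes [l] closed under [u] and [v] at once. *)
have [a|l l0 hl] := exists_closed_under rT
    (h := fun a => Order.max (u a) (v a)).
  by rewrite lt_max (uP a).1.
have ul a : (a < l)%O -> (u a < l)%O.
  by move=> /hl; rewrite gt_max => /andP[].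
have vl a : (a < l)%O -> (v a < l)%O.
  by move=> /hl; rewrite gt_max => /andP[].
have Fl := const_from_closure_image cF l0
  (fun a => (uP a).1) ul (fun a => (uP a).2).
have Gl := const_from_closure_image cG l0
  (fun a => (vP a).1) vl (fun a => (vP a).2).
(* [m] is the successor of [l], so [below m] is the ordinal [l + 1]. *)
have [m lm mle] := exists_least rT (P := [set b | (l < b)%O]) (exists_gt rT l).
have mP a : (a < m)%O -> (a <= l)%O.
  by move=> am; rewrite leNgt; apply/negP => /mle; rewrite leNgt am.
exists m; split; first by exists l.
exists (fun f => restrictCp (F (extendCp lm mP f))),
  (fun f => restrictCp (G (extendCp lm mP f))); split.
(* By [Fl] the image of an extended function is again constant from [l] on, so restricting and
   extending it changes nothing and [G] can undo [F]. *)
- move=> f; rewrite restrictCpK; last exact/Fl/extendCp_const_from.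
  rewrite FK; exact: extendCpK.
- move=> f; rewrite restrictCpK; last exact/Gl/extendCp_const_from.
  rewrite GK; exact: extendCpK.
- exact: restrict_extend_continuous.
- exact: restrict_extend_continuous.
Qed.
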